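(* Let $n \ge 1$ be an integer, let $G$ be an abelian group and let $A$ be a finite sequence in $G$. If $|A| \ge R_n(3)-1$, then $\mathrm{sdeg}(\hat{A}) \ge n+1$.
   Context: Let $(G,+)$ be an abelian group. A subset $X \subseteq G$ is sumfree if it contains no elements $x,y,z$ (not necessarily distinct) with $x+y=z$. The Schur degree $\mathrm{sdeg}(X)$ of a subset $X \subseteq G$ is the smallest integer $m \ge 1$ such that $X$ can be covered by $m$ sumfree subsets; if no such $m$ exists, $\mathrm{sdeg}(X)=\infty$. For a finite sequence $A=(a_1,\dots,a_N)$ in $G$, $|A|=N$ is its length and $\hat{A}=\{a_i+a_{i+1}+\dots+a_j \mid 1 \le i \le j \le N\}$ is its set of block sums. For $n\ge 1$, the Ramsey number $R_n(3)=R(3,\dots,3)$ is the smallest $N$ such that every coloring of the edges of the complete graph $K_N$ on $N$ vertices with $n$ colors has a monochromatic triangle. *)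

(* Defs.v *)
From HB Require Import structures.
From mathcomp Require Export all_boot all_order all_algebra.
From mathcomp Require Export boolp classical_sets constructive_ereal.

Set Implicit Arguments.
Unset Strict Implicit.
Unset Printing Implicit Defensive.

Import Order.TTheory GRing.Theory Num.Theory.

Local Open Scope ring_scope.
Local Open Scope classical_set_scope.

Section SchurDegree.
Variable G : zmodType.
Implicit Types (X : set G) (A : seq G).

Definition sumfree X : Prop :=
  forall x y z, X x -> X y -> X z -> x + y <> z.

(* The parts F i need not lie in X: a subset of a sumfree set is sumfree, so
   intersecting each part with X changes nothing. *)
Definition sumfree_coverable X (m : nat) : Prop :=
  exists F : 'I_m -> set G,
    (forall i, sumfree (F i)) /\ X `<=` \bigcup_i F i.

Definition schur_admissible X : pred nat :=
  fun m => (0 < m)%N && `[< sumfree_coverable X m >].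

Definition sdeg X : \bar int :=
  match pselect (exists m, schur_admissible X m) with
  | left exm => ((ex_minn exm)%:Z)%:E
  | right _ => +oo%E
  end.

(* Terms are indexed from 0, so that the block from i to j included is
   defined for i <= j < size A. *)
Definition block_sums A : set G :=
  [set x | exists i j : nat,
     (i <= j < size A)%N /\ x = \sum_(i <= k < j.+1) A`_k].

End SchurDegree.

(* An edge colouring of K_N is given by a function on all sets of vertices, of
   which only the values on pairs of distinct vertices are used. For n > 0
   every colouring of the edges extends to such a function (ramsey3 0 is not
   meaningful). *)
Definition mono_triangle (N n : nat) (c : {ffun {set 'I_N} -> 'I_n}) : bool :=
  [exists x, exists y, exists z,
    [&& x != y, y != z, x != z,
        c [set x; y]%SET == c [set y; z]%SET
      & c [set y; z]%SET == c [set x; z]%SET]].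

Definition triangle_forcing (n N : nat) : bool :=
  [forall c : {ffun {set 'I_N} -> 'I_n}, mono_triangle c].

Section RamseyExists.
Local Open Scope nat_scope.

Fixpoint ramsey_bound (k : nat) : nat :=
  if k is k'.+1 then (k * ramsey_bound k').+2 else 2.

Lemma triangle_in_subset (N n : nat) (c : {set 'I_N} -> 'I_n) (k : nat)
    (S : {set 'I_N}) (C : {set 'I_n}) :
  #|C| = k -> ramsey_bound k <= #|S| ->
  (forall x y, x \in S -> y \in S -> x != y -> c [set x; y]%SET \in C) ->
  exists x y z, [/\ x != y, y != z, x != z,
    c [set x; y]%SET = c [set y; z]%SET
    & c [set y; z]%SET = c [set x; z]%SET].
Proof.
elim: k S C => [|k IH] S C cardC leS inC.
  have /card_gt1P[x [y [xS yS neq_xy]]] : 1 < #|S| by [].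
  have := inC x y xS yS neq_xy.
  by rewrite (cards0_eq cardC) inE.
have /card_gt0P[v vS] : 0 < #|S| by apply: leq_trans leS.
pose nbr a := ([set x in S :\ v | c [set v; x] == a])%SET.
have [a aC big_a] : exists2 a, a \in C & ramsey_bound k <= #|nbr a|.
  apply: contrapT => small.
  have: #|(S :\ v)%SET| <= k.+1 * ramsey_bound k.
    rewrite -cardC -sum_nat_const -sum1_card.
    rewrite (partition_big (fun x => c [set v; x]%SET) (mem C)) /=; last first.
      move=> x; rewrite !inE => /andP[neq_xv xS].
      by apply: inC; rewrite // eq_sym.
    apply: leq_sum => a aC; rewrite leqNgt; apply/negP => gt_a.
    apply: small; exists a => //; apply: leq_trans (ltnW gt_a) _.
    rewrite -sum1_card; apply: eq_leq; apply: eq_bigl => x.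
    by rewrite !inE.
  by move: leS; rewrite /= (cardsD1 v S) vS add1n ltnS => /leq_trans h /h; rewrite ltnn.
have [[x [y [xa ya neq_xy cxy]]]|no_edge] := pselect (exists x y,
    [/\ x \in nbr a, y \in nbr a, x != y & c [set x; y]%SET = a]).
  move: xa ya; rewrite !inE.
  move=> /andP[/andP[xv _] /eqP cx] /andP[/andP[yv _] /eqP cy].
  exists v, x, y; split=> //; rewrite ?(eq_sym v) //.
    by rewrite cx cxy.
  by rewrite cxy cy.
apply: (IH (nbr a) (C :\ a)%SET) => //.
  by move: cardC; rewrite (cardsD1 a) aC add1n => -[].
move=> x y xa ya neq_xy; rewrite in_setD1; apply/andP; split.
  by apply/eqP => cxy; apply: no_edge; exists x, y.
by move: xa ya; rewrite !inE => /andP[/andP[_ xS] _] /andP[/andP[_ yS] _];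
  apply: inC.
Qed.

Lemma ramsey3_exists (n : nat) : exists N, triangle_forcing n N.
Proof.
exists (ramsey_bound n); apply/forallP => c.
have [||x y _ _ _|x [y [z [xy yz xz c1 c2]]]] :=
  @triangle_in_subset _ _ c n [set: _]%SET [set: _]%SET.
- by rewrite cardsT card_ord.
- by rewrite cardsT card_ord.
- by rewrite inE.
apply/existsP; exists x; apply/existsP; exists y; apply/existsP; exists z.
by rewrite xy yz xz c1 c2 !eqxx.
Qed.

End RamseyExists.

Definition ramsey3 (n : nat) : nat := ex_minn (ramsey3_exists n).

(* Main.v *)
Require Import Defs.

(** Let [P i] be the sum of the first [i] terms of [A]. The block sums of [A]
    are the differences [P j - P i] with [i < j <= size A], so they label the
    edges of the complete graph on the [(size A).+1] indices of partial sums,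
    and the three labels of a triangle [x < y < z] satisfy
    [(P y - P x) + (P z - P y) = P z - P x].

    A covering of the block sums by [n] sumfree sets therefore colours the
    edges with [n] colours (each edge gets the index of a part containing its
    label), and a monochromatic triangle would be a solution of [u + v = w]
    inside one part. Hence no such covering exists as soon as [(size A).+1] is
    at least the Ramsey number ([forcing_not_coverable]). Coverings by fewer
    than [n] sets are padded with empty sets ([sumfree_coverableW]). *)

Set Implicit Arguments.
Unset Strict Implicit.
Unset Printing Implicit Defensive.

Import GRing.Theory Num.Theory.

Local Open Scope ring_scope.
Local Open Scope classical_set_scope.

Lemma sumfree_coverableW (G : zmodType) (X : set G) (m n : nat) :
  (m <= n)%N -> sumfree_coverable X m -> sumfree_coverable X n.
Proof.
move=> le_mn [F [sfF coverF]].
(* Padding with empty sets: only the i < m come from some j. *)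
exists (fun i => [set x | exists2 j : 'I_m, j = i :> nat & F j x]).
split=> [i x y z [a ai Fx] [b bi Fy] [c ci Fz]|x /coverF [a _ Fx]].
  have ba : b = a by apply: val_inj; rewrite /= bi ai.
  have ca : c = a by apply: val_inj; rewrite /= ci ai.
  by rewrite ba in Fy; rewrite ca in Fz; apply: sfF Fx Fy Fz.
by exists (widen_ord le_mn a) => //; exists a.
Qed.

Lemma block_sums_nat (G : zmodType) (A : seq G) (i j : nat) :
  (i < j)%N -> (j <= size A)%N -> block_sums A (\sum_(i <= k < j) A`_k).
Proof. by case: j => // j lt_ij le_jA; exists i, j; rewrite -ltnS lt_ij. Qed.

Lemma set2_lt_inj (N : nat) (i j k l : 'I_N) :
  (i < j)%N -> (k < l)%N -> [set i; j]%SET = [set k; l]%SET ->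
  i = k /\ j = l.
Proof.
move=> lt_ij lt_kl eq_ij_kl.
have: i \in [set k; l]%SET by rewrite -eq_ij_kl set21.
have: j \in [set k; l]%SET by rewrite -eq_ij_kl set22.
rewrite !inE => /orP[]/eqP jE /orP[]/eqP iE; split=> //; move: lt_ij lt_kl;
  by rewrite iE jE ?ltnn // => /ltn_trans lt_ /lt_; rewrite ltnn.
Qed.

(** Edges are unordered pairs, so the three vertices of a monochromatic triangle
    may be listed in increasing order; adding the labels requires it. *)
Lemma mono_triangle_sorted (N n : nat) (c : {ffun {set 'I_N} -> 'I_n}) :
  mono_triangle c -> exists x y z : 'I_N,
    [/\ (x < y)%N, (y < z)%N, c [set x; y]%SET = c [set x; z]%SET
      & c [set y; z]%SET = c [set x; z]%SET].
Proof.
move=> /existsP[x /existsP[y /existsP[z]]].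
case/and5P=> neq_xy neq_yz neq_xz /eqP c1 /eqP c2.
have cxy : c [set x; y]%SET = c [set x; z]%SET by rewrite c1.
have swap u v : c [set u; v]%SET = c [set v; u]%SET by rewrite finset.setUC.
move: neq_xy neq_yz neq_xz; rewrite -!(inj_eq val_inj) /= !neq_ltn.
case/orP=> xy /orP[] yz /orP[] xz.
- by exists x, y, z.
- by have := ltn_trans (ltn_trans xy yz) xz; rewrite ltnn.
- by exists x, z, y; split; rewrite // ?(swap z y) ?cxy.
- by exists z, x, y; split; rewrite // ?(swap z x) ?(swap z y) ?cxy ?c2.
- by exists y, x, z; split; rewrite // ?(swap y x) ?cxy ?c2.
- by exists y, z, x; split; rewrite // ?(swap y x) ?(swap z x) ?cxy ?c2.
- by have := ltn_trans (ltn_trans yz xy) xz; rewrite ltnn.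
- by exists z, y, x; split; rewrite // ?(swap z y) ?(swap z x) ?(swap y x) ?cxy ?c2.
Qed.

(** The vertices of the graph are the [(size A).+1] cutting points of [A]: the
    edge [i < j] is labelled by the block from position [i] to [j.-1], and
    consecutive blocks concatenate. *)
Lemma forcing_not_coverable (n N : nat) (G : zmodType) (A : seq G) :
  (0 < n)%N -> (N <= (size A).+1)%N -> triangle_forcing n N ->
  ~ sumfree_coverable (block_sums A) n.
Proof.
move=> n_gt0 le_NA force [F [sfF coverF]].
have colour (e : {set 'I_N}) : {a : 'I_n | forall i j : 'I_N, (i < j)%N ->
    e = [set i; j]%SET -> F a (\sum_(i <= k < j) A`_k)}.
  apply: cid.
  have [[i [j [lt_ij ->]]]|not_edge] :=
    pselect (exists i j : 'I_N, (i < j)%N /\ e = [set i; j]%SET).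
    have le_jA : (j <= size A)%N by rewrite -ltnS (leq_trans (ltn_ord j)).
    have [a _ Fa] := coverF _ (block_sums_nat lt_ij le_jA).
    by exists a => k l lt_kl /(set2_lt_inj lt_ij lt_kl)[<- <-].
  (* Sets that are not edges are coloured too, with any colour. *)
  by exists (Ordinal n_gt0) => i j lt_ij eE; case: not_edge; exists i, j.
have [x [y [z [lt_xy lt_yz c_xy c_yz]]]] :=
  mono_triangle_sorted (forallP force [ffun e => sval (colour e)]).
rewrite !ffunE in c_xy c_yz.
have Fxy := svalP (colour [set x; y]%SET) x y lt_xy erefl.
have Fyz := svalP (colour [set y; z]%SET) y z lt_yz erefl.
have Fxz := svalP (colour [set x; z]%SET) x z (ltn_trans lt_xy lt_yz) erefl.
rewrite /= c_xy in Fxy; rewrite /= c_yz in Fyz.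
apply: (sfF _ _ _ _ Fxy Fyz Fxz).
by rewrite -big_cat_nat // ltnW.
Qed.

Theorem theorem4p1 (n : nat) (G : zmodType) (A : seq G) :
  (1 <= n)%N ->
  (ramsey3 n - 1 <= size A)%N ->
  ((n.+1%:Z)%:E <= sdeg (block_sums A))%E.
Proof.
move=> n_gt0; rewrite leq_subLR add1n => le_RA.
rewrite /sdeg; case: pselect => [exm|_]; last by rewrite leey.
case: ex_minnP => m /andP[_ /asboolP cover_m] _.
rewrite lee_fin lez_nat ltnNge; apply/negP => le_mn.
apply: (forcing_not_coverable n_gt0 le_RA); last exact: sumfree_coverableW cover_m.
by rewrite /ramsey3; case: ex_minnP.
Qed.
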